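(* Let $A\in\mathbb{R}^{n\times n}$ be nonsingular, let $\nu=\Vert A^{-1}\Vert$, and let $\omega>0$. If $$0<\nu<1\quad\text{and}\quad 0<\omega<\frac{2-2\sqrt{\nu}}{1-\nu},$$ then for any $b\in\mathbb{R}^n$ the equation $Ax-|x|-b=0$ has a unique solution $x^*\in\mathbb{R}^n$, and the sequence $\{(x^{(k)},y^{(k)})\}_{k=0}^\infty$ generated by the SOR-like iteration converges to $(x^*,y^* )$ with $y^*=|x^*|$ for any given initial vectors $x^{(0)},y^{(0)}\in\mathbb{R}^n$.
   Context: For $x\in\mathbb{R}^n$, $|x|$ is the componentwise absolute value. $\Vert\cdot\Vert$ is the matrix 2-norm. The SOR-like iteration for $Ax-|x|-b=0$ with parameter $\omega=\omega_{\rm SOR}$ is, for $k=0,1,2,\dots$, $$x^{(k+1)}=(1-\omega)x^{(k)}+\omega A^{-1}(y^{(k)}+b),\qquad y^{(k+1)}=(1-\omega)y^{(k)}+\omega|x^{(k+1)}|.$$ *)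

(* Defs.v *)
From HB Require Import structures.
From mathcomp Require Import all_boot all_order all_algebra.
From mathcomp Require Import all_classical all_reals all_analysis.

Set Implicit Arguments.
Unset Strict Implicit.
Unset Printing Implicit Defensive.

Import Order.TTheory GRing.Theory Num.Theory.
Import numFieldNormedType.Exports.

Local Open Scope classical_set_scope.
Local Open Scope ring_scope.

(* The norm `|x| that the library puts on matrices is the maximum norm, hence
   the explicit Euclidean norm and its induced operator norm below. *)

Definition norm2 (R : realType) (n : nat) (x : 'cV[R]_n) : R :=
  Num.sqrt (\sum_(i < n) x i 0 ^+ 2).

(* For n = 0 there is no unit vector, and the value is sup set0 = 0. *)
Definition mxnorm2 (R : realType) (m n : nat) (M : 'M[R]_(m, n)) : R :=
  sup [set norm2 (M *m x) | x in [set x : 'cV[R]_n | norm2 x = 1]].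

Definition abs_cV (R : realType) (n : nat) (x : 'cV[R]_n) : 'cV[R]_n :=
  map_mx (fun t : R => `|t|) x.

Definition sor_like_step (R : realType) (n : nat) (A : 'M[R]_n) (b : 'cV[R]_n)
    (omega : R) (z : 'cV[R]_n * 'cV[R]_n) : 'cV[R]_n * 'cV[R]_n :=
  let x' := (1 - omega) *: z.1 + omega *: (invmx A *m (z.2 + b)) in
  let y' := (1 - omega) *: z.2 + omega *: abs_cV x' in
  (x', y').

Definition sor_like (R : realType) (n : nat) (A : 'M[R]_n) (b : 'cV[R]_n)
    (omega : R) (x0 y0 : 'cV[R]_n) (k : nat) : 'cV[R]_n * 'cV[R]_n :=
  iter k (sor_like_step A b omega) (x0, y0).

(* Main.v *)
Require Import Defs.
From HB Require Import structures.
From mathcomp Require Import all_boot all_order all_algebra.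
From mathcomp Require Import all_classical all_reals all_analysis.
From mathcomp Require Import ring lra.

Set Implicit Arguments.
Unset Strict Implicit.
Unset Printing Implicit Defensive.

Import Order.TTheory GRing.Theory Num.Theory.
Import numFieldNormedType.Exports.

Local Open Scope classical_set_scope.
Local Open Scope ring_scope.

(** One step of the iteration is a contraction of R^n x R^n for a suitable
    norm, and everything follows from the fixed-point principle.

    Write s = sqrt nu and let (u, v) be the difference of two states, (u', v')
    that of their successors.  Since A^-1 has operator norm s^2 and the
    componentwise absolute value is 1-Lipschitz for the Euclidean norm,
      |u'| <= |1 - omega| |u| + omega s^2 |v|,
      |v'| <= |1 - omega| |v| + omega |u'|.
    Measuring v in units of 1/s makes the two couplings equal to omega s: with
    M = max(|u|, s |v|), the first line gives |u'| <= rho M for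
    rho = |1 - omega| + omega s, and, once rho <= 1, the second one gives
    s |v'| <= |1 - omega| M + omega s M = rho M ([sor_like_step_contr]).

    The upper bound on omega is 2 / (1 + s) because
    (2 - 2 s) / (1 - s^2) = 2 / (1 + s), and for 0 < s < 1 the condition
    omega < 2 / (1 + s) gives rho < 1: if omega <= 1 then
    rho = 1 - omega (1 - s), otherwise rho = omega (1 + s) - 1
    ([relaxation_factor_lt1]).

    A contraction for a function equivalent to the norm of a complete space has
    a unique fixed point, which attracts every orbit
    ([gauge_contraction_fixpoint]).  The fixed points of the step are exactly
    the pairs (x, |x|) with A x - |x| - b = 0 ([sor_like_step_fixed]), so the
    same argument yields existence, uniqueness and convergence. *)

(** * The Euclidean norm *)

Lemma sum_le_card (R : realType) (n : nat) (f : 'I_n -> R) (c : R) :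
  (forall i, f i <= c) -> \sum_(i < n) f i <= n%:R * c.
Proof.
by move=> h; rewrite mulr_natl -[n in leRHS]card_ord -sumr_const ler_sum.
Qed.

Lemma mx_entry_le_norm (R : realType) m p (M : 'M[R]_(m, p)) i j : `|M i j| <= `|M|.
Proof. by rewrite [leRHS]mx_normrE; apply: (le_bigmax _ _ (i, j)). Qed.

Section Norm2.
Variables (R : realType) (n : nat).
Implicit Types x y : 'cV[R]_n.

Lemma norm2_ge0 x : 0 <= norm2 x.
Proof. exact: sqrtr_ge0. Qed.

Lemma sqr_norm2 x : norm2 x ^+ 2 = \sum_(i < n) x i 0 ^+ 2.
Proof. by rewrite sqr_sqrtr// sumr_ge0// => i _; exact: sqr_ge0. Qed.

Lemma norm2_le x c : 0 <= c ->
  \sum_(i < n) x i 0 ^+ 2 <= c ^+ 2 -> norm2 x <= c.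
Proof. by move=> c0 h; rewrite -(@ler_pXn2r _ 2) ?nnegrE ?norm2_ge0// sqr_norm2. Qed.

Lemma norm2Z (a : R) x : norm2 (a *: x) = `|a| * norm2 x.
Proof.
rewrite /norm2 -sqrtr_sqr -sqrtrM ?sqr_ge0// mulr_sumr.
by congr Num.sqrt; apply: eq_bigr => i _; rewrite mxE exprMn.
Qed.

Lemma entry_le_norm2 x i : `|x i 0| <= norm2 x.
Proof.
rewrite -(@ler_pXn2r _ 2) ?nnegrE ?norm2_ge0// sqr_norm2 real_normK ?num_real//.
by rewrite (bigD1 i)//= lerDl sumr_ge0// => j _; exact: sqr_ge0.
Qed.

(** With [norm2_le_norm], this compares the Euclidean norm with the maximum
    norm, which defines the topology on matrices. *)
Lemma norm_le_norm2 x : `|x| <= norm2 x.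
Proof.
rewrite [leLHS]mx_normrE bigmax_le ?norm2_ge0// => -[i j] _ /=.
by rewrite ord1 entry_le_norm2.
Qed.

Lemma norm2_le_norm x : norm2 x <= n%:R * `|x|.
Proof.
have S0 : 0 <= \sum_(i < n) `|x i 0| by rewrite sumr_ge0.
apply: (@le_trans _ _ (\sum_(i < n) `|x i 0|)).
  (* with S the sum of the absolute values, x_i^2 <= |x_i| S for each i *)
  apply: norm2_le => //; rewrite expr2 mulr_suml; apply: ler_sum => i _.
  rewrite -real_normK ?num_real// expr2 ler_wpM2l//.
  by rewrite (bigD1 i)//= lerDl sumr_ge0.
by apply: sum_le_card => i; exact: mx_entry_le_norm.
Qed.

Lemma norm2_eq0 x : norm2 x = 0 -> x = 0.
Proof. by move=> x0; apply/eqP; rewrite -normr_le0 -x0 norm_le_norm2. Qed.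

(** The expansion of sum (t x_i - s y_i)^2 >= 0, where s and t are the norms of
    x and y, is 2 s t (s t - <x, y>) >= 0. *)
Lemma cauchy_schwarz2 x y :
  \sum_(i < n) x i 0 * y i 0 <= norm2 x * norm2 y.
Proof.
set s := norm2 x; set t := norm2 y.
have [s0 t0] : 0 <= s /\ 0 <= t by split; exact: norm2_ge0.
have [/norm2_eq0 ->|sN0] := eqVneq s 0.
  by rewrite big1 ?mulr_ge0// => i _; rewrite mxE mul0r.
have [/norm2_eq0 ->|tN0] := eqVneq t 0.
  by rewrite big1 ?mulr_ge0// => i _; rewrite mxE mulr0.
have st0 : 0 < 2 * (s * t) by rewrite !mulr_gt0// lt0r ?sN0 ?tN0.
have : 0 <= \sum_(i < n) (t * x i 0 - s * y i 0) ^+ 2.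
  by rewrite sumr_ge0// => i _; exact: sqr_ge0.
have -> : \sum_(i < n) (t * x i 0 - s * y i 0) ^+ 2 =
    t ^+ 2 * (\sum_(i < n) x i 0 ^+ 2) + s ^+ 2 * (\sum_(i < n) y i 0 ^+ 2)
    - 2 * (s * t) * (\sum_(i < n) x i 0 * y i 0).
  rewrite !mulr_sumr -sumrN -!big_split /=; apply: eq_bigr => i _; ring.
rewrite -!sqr_norm2 -/s -/t => h; rewrite -(ler_pM2l st0); nra.
Qed.

Lemma ler_norm2D x y : norm2 (x + y) <= norm2 x + norm2 y.
Proof.
apply: norm2_le; first by rewrite addr_ge0 ?norm2_ge0.
have -> : \sum_(i < n) (x + y) i 0 ^+ 2 =
    \sum_(i < n) x i 0 ^+ 2 + \sum_(i < n) y i 0 ^+ 2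
    + 2 * \sum_(i < n) x i 0 * y i 0.
  by rewrite !mulr_sumr -!big_split /=; apply: eq_bigr => i _; rewrite mxE; ring.
rewrite -!sqr_norm2; have := cauchy_schwarz2 x y; lra.
Qed.

Lemma norm2_abs_lip x y : norm2 (abs_cV x - abs_cV y) <= norm2 (x - y).
Proof.
apply: norm2_le; first exact: norm2_ge0.
rewrite sqr_norm2; apply: ler_sum => i _; rewrite !mxE.
by rewrite -[leRHS]real_normK ?num_real// -[leLHS]real_normK ?num_real//
  ler_pXn2r ?nnegrE// ler_dist_dist.
Qed.

End Norm2.

(** The supremum defining [mxnorm2 M] is over unit vectors, so the point is that
    this set of values is bounded above: otherwise [sup] would be the default
    value 0.  The maximum norm provides a crude bound. *)
Lemma norm2_mulmx (R : realType) (m n : nat) (M : 'M[R]_(m, n)) (x : 'cV[R]_n) :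
  norm2 (M *m x) <= mxnorm2 M * norm2 x.
Proof.
have [/norm2_eq0 ->|x0] := eqVneq (norm2 x) 0.
  rewrite mulmx0 -[0 in leLHS](scale0r 0) -[0 in leRHS](scale0r 0).
  by rewrite !norm2Z normr0 !mul0r mulr0.
have xp : 0 < norm2 x by rewrite lt0r x0 norm2_ge0.
set u := (norm2 x)^-1 *: x.
have nu : norm2 u = 1 by rewrite norm2Z gtr0_norm ?invr_gt0// mulVf.
have -> : x = norm2 x *: u by rewrite scalerA divff// scale1r.
rewrite -scalemxAr [leLHS]norm2Z [in leRHS]norm2Z nu mulr1 mulrC gtr0_norm//.
rewrite ler_pM2r//.
apply: ub_le_sup; last by exists u.
exists (m%:R * (n%:R * `|M|)) => _ [z /= z1 <-].
apply: (le_trans (norm2_le_norm _)); rewrite ler_wpM2l//.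
rewrite [leLHS]mx_normrE bigmax_le ?mulr_ge0// => -[i j] _ /=.
rewrite ord1 mxE (le_trans (ler_norm_sum _ _ _))//.
apply: sum_le_card => k; rewrite normrM -[leRHS]mulr1 ler_pM//.
  exact: mx_entry_le_norm.
by rewrite -z1 entry_le_norm2.
Qed.

(** * Contractions of the product space *)

(** The increments form a series that converges absolutely. *)
Lemma geometric_increments_cvg (R : realType) (V : completeNormedModType R)
    (u : V^nat) (C rho : R) :
  0 <= rho < 1 -> (forall k, `|u k.+1 - u k| <= C * rho ^+ k) -> cvgn u.
Proof.
move=> /andP[rho0 rho1] hu.
have : cvgn (series (telescope u)).
  apply: normed_cvg.
  apply: (@series_le_cvg _ _ (geometric C rho)) => [k|k|k|].
  - exact: normr_ge0.
  - by rewrite /= (le_trans _ (hu k)).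
  - exact: hu.
  - by apply: is_cvg_geometric_series; rewrite ger0_norm.
move=> ct; have -> : u = (fun k => u 0%N + series (telescope u) k).
  by apply/funext => k; rewrite telescopeK addrC subrK.
by apply: is_cvgD => //; exact: is_cvg_cst.
Qed.


(** Matrices are canonically a complete uniform space and a normed module; this
    declares their join, a complete normed module. *)
HB.instance Definition _ (R : realType) (m n : nat) := Complete.on 'M[R]_(m, n).

(** A gauge [N] is any function squeezed between two multiples of the norm.
    The fixed-point principle is needed for a gauge because the contraction
    property depends on the choice of norm, and the step does not have to
    contract the maximum norm. *)
Section Gauge.
Variables (R : realType) (U V : completeNormedModType R).
Let W : normedModType R := (U * V)%type.
Variables (N : W -> R) (a b : R).
Hypothesis N0 : forall v, 0 <= N v.
Hypothesis norm_le_N : forall v, `|v| <= a * N v.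
Hypothesis N_le_norm : forall v, N v <= b * `|v|.

Lemma gauge_cvgP (u : W^nat) (l : W) :
  u @ \oo --> l <-> N (u k - l) @[k --> \oo] --> (0 : R).
Proof.
split => h.
  have h' : b * `|u k - l| @[k --> \oo] --> (0 : R).
    rewrite -[X in _ --> X](mulr0 b); apply: cvgMr.
    by apply/norm_cvg0P; apply/subr_cvg0.
  apply: squeeze_cvgr h'; last exact: cvg_cst.
  by apply: nearW => k; rewrite N0 N_le_norm.
apply/subr_cvg0/norm_cvg0P.
have h' : a * N (u k - l) @[k --> \oo] --> (0 : R).
  by rewrite -[X in _ --> X](mulr0 a); apply: cvgMr.
apply: squeeze_cvgr h'; last exact: cvg_cst.
by apply: nearW => k; rewrite normr_ge0 norm_le_N.
Qed.

Variables (rho : R) (F : W -> W).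
Hypothesis rho01 : 0 <= rho < 1.
Hypothesis F_contr : forall v w, N (F v - F w) <= rho * N (v - w).

Lemma gauge_iter_contr k v w :
  N (iter k F v - iter k F w) <= rho ^+ k * N (v - w).
Proof.
have /andP[rho0 _] := rho01.
elim: k => [|k IH]; first by rewrite expr0 mul1r.
by rewrite !iterS (le_trans (F_contr _ _))// exprS -mulrA ler_wpM2l.
Qed.

(** Completeness enters through the two components of the orbit of 0, whose
    increments decay like [rho ^+ k].  Its limit is fixed since the shifted
    orbit tends both to [l] and, by contraction, to [F l].  *)
Lemma gauge_contraction_fixpoint :
  exists l, unique (fun v => F v = v) l /\
    forall v, iter k F v @[k --> \oo] --> l.
Proof.
have /andP[rho0 rho1] := rho01.
have a0 : 0 <= `|a| by [].
set u := fun k => iter k F 0.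
have du k : `|u k.+1 - u k| <= `|a| * N (F 0 - 0) * rho ^+ k.
  rewrite /u iterSr (le_trans (norm_le_N _))//.
  rewrite (le_trans (ler_wpM2r (N0 _) (ler_norm a)))// -mulrA ler_wpM2l//.
  by rewrite mulrC gauge_iter_contr.
have /cvg_ex[l1 ul1] : cvgn (fst \o u).
  apply: geometric_increments_cvg rho01 _ => k.
  by apply: le_trans (du k); rewrite prod_normE le_max lexx.
have /cvg_ex[l2 ul2] : cvgn (snd \o u).
  apply: geometric_increments_cvg rho01 _ => k.
  by apply: le_trans (du k); rewrite prod_normE le_max lexx orbT.
pose l : W := (l1, l2).
have ul : u @ \oo --> l.
  apply: cvg_trans (cvg_pair ul1 ul2).
  by move=> A; rewrite /nbhs/=; apply: filterS => k /=; case: (u k).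
have lF : F l = l.
  apply: (@cvg_unique W (@norm_hausdorff _ W) (iter k.+1 F 0 @[k --> \oo])).
    apply/(gauge_cvgP (fun k => iter k.+1 F 0)).
    have h : rho * N (iter k F 0 - l) @[k --> \oo] --> (0 : R).
      by rewrite -[X in _ --> X](mulr0 rho); apply: cvgMr; exact/gauge_cvgP.
    apply: squeeze_cvgr h; last exact: cvg_cst.
    by apply: nearW => k; rewrite N0 iterS F_contr.
  by move: ul; rewrite -(cvg_shiftS (fun k => iter k F 0)).
have iter_fix k v : F v = v -> iter k F v = v by move=> Fv; elim: k => //= k ->.
have iter_l v : iter k F v @[k --> \oo] --> l; last first.
  exists l; split => //; split => // v Fv.
  apply: (@cvg_unique W (@norm_hausdorff _ W) (iter k F v @[k --> \oo])).
    exact: iter_l.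
  have -> : (fun k => iter k F v) = (fun=> v) by apply/funext => k; exact: iter_fix.
  exact: cvg_cst.
apply/(gauge_cvgP (fun k => iter k F v)).
have h : rho ^+ k * N (v - l) @[k --> \oo] --> (0 : R).
  rewrite -[X in _ --> X](mul0r (N (v - l))); apply: cvgMl.
  by apply: cvg_expr; rewrite ger0_norm.
apply: squeeze_cvgr h; last exact: cvg_cst.
by apply: nearW => k; rewrite N0/= -{1}(iter_fix k l lF) gauge_iter_contr.
Qed.

End Gauge.

(** * The SOR-like iteration *)

(** The weight [s] will be the square root of the norm of the inverse matrix: it
    balances the two couplings between the x and y components. *)
Definition wnorm (R : realType) (n : nat) (s : R)
    (z : 'cV[R]_n * 'cV[R]_n) : R :=
  Num.max (norm2 z.1) (s * norm2 z.2).

Section SorLike.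
Variables (R : realType) (n : nat).
Implicit Types (z w : 'cV[R]_n * 'cV[R]_n) (s : R).

Lemma wnorm_ge0 s z : 0 <= wnorm s z.
Proof. by rewrite le_max norm2_ge0. Qed.

Lemma norm_le_wnorm s z : 0 < s -> `|z| <= (1 + s^-1) * wnorm s z.
Proof.
move=> s0; have si : 0 < s^-1 by rewrite invr_gt0.
rewrite prod_normE ge_max mulrDl mul1r; apply/andP; split.
  apply: (le_trans (norm_le_norm2 _)); apply: ler_wpDr.
    by rewrite mulr_ge0 ?wnorm_ge0// ltW.
  by rewrite le_max lexx.
apply: (le_trans (norm_le_norm2 _)); apply: ler_wpDl; first exact: wnorm_ge0.
by rewrite ler_pdivlMl// le_max lexx orbT.
Qed.

Lemma wnorm_le_norm s z : 0 < s -> wnorm s z <= (1 + s) * n%:R * `|z|.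
Proof.
move=> s0; have b0 : 0 <= n%:R * `|z| by rewrite mulr_ge0.
have b1 : norm2 z.1 <= n%:R * `|z|.
  by rewrite (le_trans (norm2_le_norm _))// ler_wpM2l// prod_normE le_max lexx.
have b2 : norm2 z.2 <= n%:R * `|z|.
  rewrite (le_trans (norm2_le_norm _))// ler_wpM2l// prod_normE le_max.
  by rewrite lexx orbT.
rewrite -mulrA mulrDl mul1r ge_max; apply/andP; split.
  by rewrite ler_wpDr// mulr_ge0// ltW.
by rewrite ler_wpDl// ler_wpM2l// ltW.
Qed.

(** The new y is computed from the new x, hence the bound on the x component
    is reused for the y component; this is where [rho <= 1] matters. *)
Lemma sor_like_step_contr (A : 'M[R]_n) (b : 'cV[R]_n) (omega s : R) z w :
  0 <= omega -> 0 <= s -> mxnorm2 (invmx A) = s ^+ 2 ->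
  `|1 - omega| + omega * s <= 1 ->
  wnorm s (sor_like_step A b omega z - sor_like_step A b omega w)
    <= (`|1 - omega| + omega * s) * wnorm s (z - w).
Proof.
move=> om0 s0 nuE; set rho := `|1 - omega| + omega * s => rho1.
set z' := sor_like_step _ _ _ z; set w' := sor_like_step _ _ _ w.
set M := wnorm s (z - w).
have M1 : norm2 (z.1 - w.1) <= M by rewrite le_max lexx.
have M2 : s * norm2 (z.2 - w.2) <= M by rewrite le_max lexx orbT.
have M0 : 0 <= M := wnorm_ge0 _ _.
have dx : norm2 (z'.1 - w'.1) <= rho * M.
  have -> : z'.1 - w'.1 = (1 - omega) *: (z.1 - w.1)
      + omega *: (invmx A *m (z.2 - w.2)).
    rewrite /= opprD addrACA -!scalerBr -mulmxBr.
    by rewrite opprD addrACA subrr addr0.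
  rewrite (le_trans (ler_norm2D _ _))// !norm2Z mulrDl (ger0_norm om0).
  rewrite lerD ?ler_wpM2l// -mulrA ler_wpM2l//.
  rewrite (le_trans (norm2_mulmx _ _))// nuE expr2 -mulrA ler_wpM2l//.
have dy : s * norm2 (z'.2 - w'.2) <= rho * M.
  have -> : z'.2 - w'.2 = (1 - omega) *: (z.2 - w.2)
      + omega *: (abs_cV z'.1 - abs_cV w'.1).
    by rewrite /= opprD addrACA -!scalerBr.
  have := ler_norm2D ((1 - omega) *: (z.2 - w.2))
    (omega *: (abs_cV z'.1 - abs_cV w'.1)).
  move=> /(ler_wpM2l s0) /le_trans; apply.
  rewrite !norm2Z (ger0_norm om0) mulrDr mulrDl lerD//.
    by rewrite mulrCA ler_wpM2l.
  rewrite mulrA [s * _]mulrC ler_wpM2l ?mulr_ge0//.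
  rewrite (le_trans (norm2_abs_lip _ _))// (le_trans dx)//.
  by rewrite -[leRHS]mul1r ler_wpM2r.
by rewrite ge_max; apply/andP; split.
Qed.

(** Both updates are relaxations [(1 - omega) *: u + omega *: v], which leave
    [u] in place exactly when [v = u]. *)
Lemma sor_like_step_fixed (A : 'M[R]_n) (b : 'cV[R]_n) (omega : R) x y :
  A \in unitmx -> omega != 0 ->
  sor_like_step A b omega (x, y) = (x, y) <->
  A *m x - abs_cV x - b = 0 /\ y = abs_cV x.
Proof.
move=> Au om0.
have relax (u v : 'cV[R]_n) : (1 - omega) *: u + omega *: v = u <-> v = u.
  split=> [|->]; last by rewrite -scalerDl subrK scale1r.
  rewrite scalerBl scale1r -addrA -[RHS]addr0 => /addrI/eqP.
  by rewrite addrC subr_eq0 => /eqP/(scalerI om0).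
have solve v : invmx A *m v = x <-> A *m x = v.
  by split=> [<-|<-]; rewrite mulmxA ?mulmxV ?mulVmx ?mul1mx.
split=> [[xE yE]|[eqx ->]].
  rewrite xE in yE; move/relax/solve: xE => ->; move/relax: yE => <-.
  by rewrite addrAC addrK subrr.
have xE : invmx A *m (abs_cV x + b) = x.
  by apply/solve/eqP; rewrite -subr_eq0 opprD addrA eqx.
have x'E : (1 - omega) *: x + omega *: (invmx A *m (abs_cV x + b)) = x.
  exact/relax.
by rewrite /sor_like_step /= x'E; congr pair; exact/relax.
Qed.

(** The bound on [omega] simplifies to [omega * (1 + s) < 2]. *)
Lemma relaxation_factor_lt1 (s omega : R) : 0 < s < 1 ->
  0 < omega < (2 - 2 * s) / (1 - s ^+ 2) -> `|1 - omega| + omega * s < 1.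
Proof.
move=> /andP[s0 s1] /andP[om0]; rewrite ltr_pdivlMr; last by nra.
move=> h; have om2 : omega * (1 + s) < 2 by nra.
by case: (leP 0 (1 - omega)) => ?; [rewrite ger0_norm//|rewrite ltr0_norm//]; nra.
Qed.

End SorLike.

Theorem corollary13 (R : realType) (n : nat) (A : 'M[R]_n) (nu omega : R)
    (hA : A \in unitmx)
    (hnu : nu = mxnorm2 (invmx A))
    (homega : 0 < omega)
    (nu_bounds : 0 < nu < 1)
    (omega_bounds : 0 < omega < (2 - 2 * Num.sqrt nu) / (1 - nu))
    (b : 'cV[R]_n) :
  exists xs ys : 'cV[R]_n,
    [/\ unique (fun x : 'cV[R]_n => A *m x - abs_cV x - b = 0) xs,
        ys = abs_cV xs
      & forall x0 y0 : 'cV[R]_n,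
          sor_like A b omega x0 y0 k @[k --> \oo] --> (xs, ys)].
Proof.
have /andP[nu0 nu1] := nu_bounds.
set s := Num.sqrt nu in omega_bounds.
have nuE : nu = s ^+ 2 by rewrite sqr_sqrtr// ltW.
have s0 : 0 < s by rewrite sqrtr_gt0.
have s1 : s < 1 by rewrite -(@ltr_pXn2r _ 2) ?nnegrE ?ltW// -nuE expr1n.
have rho1 : `|1 - omega| + omega * s < 1.
  by apply: relaxation_factor_lt1; rewrite -?nuE// s0.
have rho01 : 0 <= `|1 - omega| + omega * s < 1.
  by rewrite rho1 andbT addr_ge0// mulr_ge0// ltW.
have fixedE := sor_like_step_fixed b _ _ hA (lt0r_neq0 homega).
have [] := @gauge_contraction_fixpoint R _ _ (@wnorm R n s) _ _ (wnorm_ge0 s)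
  (fun z => norm_le_wnorm z s0) (fun z => wnorm_le_norm z s0) _
  (sor_like_step A b omega) rho01.
  move=> z w; apply: sor_like_step_contr; rewrite ?ltW//.
  by rewrite -hnu.
move=> [xs ys] [[/fixedE[xsE ysE] uniq_z] cvg_z].
exists xs, ys; split => // [|x0 y0]; last exact: cvg_z.
split=> // x xE.
by have [] := uniq_z (x, abs_cV x) (proj2 (fixedE _ _) (conj xE erefl)).
Qed.
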